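(* Let $n\geq 1$. The map $\hat\Psi:\mathfrak{D}_n\to\mathfrak{D}_n$, $\hat\Psi=\mathrm{sefToPerm}\circ\Psi\circ\mathrm{sefToPerm}^{-1}$, is an involution satisfying the following properties: (i) the excedance value set is preserved: $\mathrm{EXCv}(\hat\Psi(\sigma))=\mathrm{EXCv}(\sigma)$ for all $\sigma\in\mathfrak{D}_n$; (ii) the set of right-to-left minima is preserved: $\mathrm{RLMv}(\hat\Psi(\sigma))=\mathrm{RLMv}(\sigma)$ for all $\sigma\in\mathfrak{D}_n$; (iii) whenever $\sigma\in\mathfrak{D}_n^*$, $\mathrm{sgn}(\hat\Psi(\sigma))=-\mathrm{sgn}(\sigma)$.
   Context: **Permutations.** $[n]=\{1,\dots,n\}$; $\mathfrak{S}_n$ is the symmetric group on $[n]$; $\mathfrak{D}_n\subseteq\mathfrak{S}_n$ is the set of derangements (permutations without fixed points). $\mathrm{sgn}(\sigma)$ is the usual sign. $\mathrm{EXCv}(\sigma)=\{\sigma(j):j\in[n],\ \sigma(j)>j\}$. $\mathrm{RLMv}(\sigma)=\{\sigma(i): i\in[n],\ \sigma(i)<\sigma(j)\text{ for all }j\in\{i+1,\dots,n\}\}$. **Subexcedant functions.** A subexcedant function on $[n]$ is a map $f:[n]\to[n]$ with $1\le f(i)\le i$ for all $i$; it is written as the word $f(1)f(2)\dots f(n)$. $\mathcal{F}_n$ is the set of these, and $\mathrm{IM}(f)=\{f(i):i\in[n]\}$. The map $\mathrm{sefToPerm}:\mathcal{F}_n\to\mathfrak{S}_n$, $\mathrm{sefToPerm}(f)=(n\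 f(n))\cdots(2\ f(2))(1\ f(1))$ (product of transpositions, rightmost factor applied first, $(i\ i)$ meaning the identity) is a bijection; put $f_\sigma=\mathrm{sefToPerm}^{-1}(\sigma)$. Let $\mathcal{DF}_n=\{f_\sigma:\sigma\in\mathfrak{D}_n\}$. A subexcedant function $f$ on $[n]$ is *matchless* if $f=1\,1\,2\,3\cdots(k{-}1)\,k\,k\cdots k$ for some $1\le k\le n-1$, i.e. $f(1)=1$ and $f(j)=\min(j-1,k)$ for $2\le j\le n$. $\mathfrak{D}_n^*$ is the set of derangements $\sigma$ such that $f_\sigma$ is not matchless. **The map $\Psi:\mathcal{DF}_n\to\mathcal{DF}_n$.** If $f\in\mathcal{DF}_n$ is matchless, $\Psi(f)=f$. Otherwise write $\mathrm{IM}(f)=\{\mathbf{m}_1<\mathbf{m}_2<\dots<\mathbf{m}_\ell\}$ (so $\mathbf{m}_1=1$, $\ell\ge2$). For $i\in\{2,\dots,\ell\}$, $\mathrm{fix}_i(f)$ is obtained from $f$ by changing its value at $\mathbf{m}_i$ to $\mathbf{m}_i$, and $\mathrm{unfix}_i(f)$ by changing its value at $\mathbf{m}_i$ to $\mathbf{m}_{i-1}$; all other values are unchanged. Say that $\circledast_i$ holds for $f$ if $f(\mathbf{m}_i)<\mathbf{m}_i<\mathbf{m}_\ell$, $f^{-1}(1)=\{1,2\}$, and $\{\mathbf{m}_i+1\}\subsetneq f^{-1}(\mathbf{m}_i)$. Let $i\in\{2,\dots,\ell\}$ be the smallest index satisfying one of the following (mutually exclusive) cases; such an $i$ exists whenever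 $f\in\mathcal{DF}_n$ is not matchless. Then: - Case $\heartsuit_i$: $f(\mathbf{m}_i)=\mathbf{m}_i$; then $\Psi(f)=\mathrm{unfix}_i(f)$. - Case $\spadesuit_i$: $f(\mathbf{m}_i)<\mathbf{m}_i$ and $|f^{-1}(1)|\ge3$; then $\Psi(f)=\mathrm{fix}_i(f)$. - Case $\diamondsuit_i$: $\circledast_i$ holds and $f(\mathbf{m}_{i+1})=\mathbf{m}_{i+1}$; then $\Psi(f)=\mathrm{unfix}_{i+1}(f)$. - Case $\clubsuit_i$: $\circledast_i$ holds and $f(\mathbf{m}_{i+1})<\mathbf{m}_{i+1}$; then $\Psi(f)=\mathrm{fix}_{i+1}(f)$. *)

(* Defs.v *)
(* The set [n+1] = {1, ..., n+1} is represented by 'I_n.+1 = {0, ..., n}, so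
   that letting n range over nat covers every [N] with N >= 1.  Every position,
   every value, and every index i of the elements m_i of the image of a function
   is thus shifted down by one. *)
From HB Require Import structures.
From mathcomp Require Import all_boot all_order all_fingroup all_algebra.

Set Implicit Arguments.
Unset Strict Implicit.
Unset Printing Implicit Defensive.

Section Permutations.
Variable n : nat.
Implicit Type s : 'S_n.+1.

Definition derangements : {set 'S_n.+1} := [set s : 'S_n.+1 | [forall i, s i != i]].

Definition EXCv s : {set 'I_n.+1} := [set s j | j : 'I_n.+1 & j < s j].

Definition RLMv s : {set 'I_n.+1} :=
  [set s i | i : 'I_n.+1 & [forall j : 'I_n.+1, (i < j) ==> (s i < s j)]].

Definition sgn s : int := ((-1) ^+ odd_perm s)%R.

End Permutations.

Section SubexcedantFunctions.
Variable n : nat.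

Definition subexcedant (f : {ffun 'I_n.+1 -> 'I_n.+1}) :=
  [forall i, f i <= i].

Record sef := Sef {
  sef_val :> {ffun 'I_n.+1 -> 'I_n.+1};
  sefP : subexcedant sef_val }.

HB.instance Definition _ := [isSub for sef_val].
HB.instance Definition _ := [Finite of sef by <:].

Implicit Types (f g : sef) (i : nat) (p v : 'I_n.+1).

Lemma sef_le f p : f p <= p.
Proof. exact: (forallP (sefP f) p). Qed.

(* In MathComp the left factor of a product of permutations is applied first, so
   this is (n f(n)) ... (2 f(2)) (1 f(1)) read from right to left. *)
Definition sefToPerm f : 'S_n.+1 := (\prod_(i < n.+1) tperm i (f i))%g.

Lemma sefToPerm_inj : injective sefToPerm.
Proof.
pose P f k := (\prod_(0 <= i < k) tperm (inord i) (f (inord i)) : 'S_n.+1)%g.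
have PE f : sefToPerm f = P f n.+1.
  rewrite /P big_mkord; apply: eq_bigr => i _.
  by rewrite inord_val.
have Pfix f k p : k <= p -> P f k p = p.
  elim: k => [|k IHk] ltkp; first by rewrite /P big_nil perm1.
  rewrite /P big_nat_recr //= permM IHk ?(ltnW ltkp) //.
  have ltkn : k < n.+1 by apply: leq_trans (ltn_ord p); apply: ltnW.
  have := sef_le f (inord k); rewrite inordK // => lefk.
  rewrite tpermD //; apply/eqP => E; move: ltkp.
    by rewrite -E inordK // ltnn.
  by rewrite -E ltnNge lefk.
have Pinj f g k : k <= n.+1 -> P f k = P g k ->
    forall p, p < k -> f p = g p.
  elim: k => [|k IHk] // lekn eqPk p; rewrite ltnS leq_eqVlt.
  have fk h : P h k.+1 (inord k) = h (inord k).
    by rewrite /P big_nat_recr //= permM Pfix ?inordK // tpermL.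
  have eqk : f (inord k) = g (inord k) by rewrite -!fk eqPk.
  case/orP=> [/eqP Ep|]; first by rewrite -(inord_val p) Ep.
  apply: IHk; first exact: ltnW.
  by move: eqPk; rewrite /P !big_nat_recr //= eqk => /mulIg.
move=> f g; rewrite !PE => /(Pinj _ _ _ (leqnn _)) E.
by apply/val_inj/ffunP => p; apply: E.
Qed.

Lemma card_sef : #|{: sef}| = n.+1`!.
Proof.
rewrite card_sub.
rewrite (eq_card (B := family (fun i : 'I_n.+1 => [pred j : 'I_n.+1 | j <= i]))).
  rewrite card_family fact_prod big_add1 /= big_mkord.
  rewrite foldrE big_map big_enum /=; apply: eq_bigr => i _.
  have winj : injective (widen_ord (ltn_ord i)).
    by move=> x y /(congr1 val)/= /val_inj.
  rewrite -[RHS](card_ord i.+1) -(card_image winj).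
  apply: eq_card => j; apply/idP/imageP => [le|[k _ ->]].
    by exists (Ordinal (le : j < i.+1)) => //; apply: val_inj.
  exact: (ltn_ord k).
by move=> f; apply/forallP/familyP => H p; apply: (H p).
Qed.

Lemma sefToPerm_onto (s : 'S_n.+1) : s \in codom sefToPerm.
Proof.
apply: (inj_card_onto sefToPerm_inj).
by rewrite card_sef card_Sn.
Qed.

Definition permToSef (s : 'S_n.+1) : sef := iinv (sefToPerm_onto s).

Lemma permToSefK : cancel permToSef sefToPerm.
Proof. by move=> s; apply: f_iinv. Qed.

Lemma sefToPermK : cancel sefToPerm permToSef.
Proof. by move=> f; apply: sefToPerm_inj; rewrite permToSefK. Qed.

(* The value 0 of j.-1 at j = 0 encodes f(1) = 1. *)
Definition matchless f :=
  [exists k : 'I_n, [forall j, f j == minn j.-1 k :> nat]].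

Definition derangements_star : {set 'S_n.+1} :=
  [set s : 'S_n.+1 in derangements n | ~~ matchless (permToSef s)].

Definition IM f : {set 'I_n.+1} := [set f p | p : 'I_n.+1].

Definition fiber f v : {set 'I_n.+1} := [set p | f p == v].

(* The elements of IM f in increasing order (enum lists ordinals increasingly);
   the default ord_max, used for i >= #|IM f|, only serves to make m f
   nondecreasing on the whole of nat. *)
Definition m f i : 'I_n.+1 := nth ord_max (enum (IM f)) i.

Definition mlast f : 'I_n.+1 := m f #|IM f|.-1.

Lemma m_pred_le f i : m f i.-1 <= m f i.
Proof.
case: i => [|i] //=; rewrite /m.
have [lti|gei] := ltnP i.+1 (size (enum (IM f))); last first.
  by rewrite (nth_default _ gei) -ltnS.
have srt : sorted (relpre val leq) (enum (IM f)).
  rewrite /enum_mem -enumT; apply: sorted_filter.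
    by move=> x y z /=; apply: leq_trans.
  by rewrite -sorted_map val_enum_ord iota_sorted.
exact: (sortedP ord_max srt).
Qed.

Lemma subexcedant_set f p v : v <= p ->
  subexcedant [ffun q => if q == p then v else f q].
Proof.
move=> levp; apply/forallP=> q; rewrite ffunE.
by case: eqP => [->|_] //; apply: sef_le.
Qed.

Definition fix_at f i : sef := Sef (subexcedant_set f (leqnn (m f i))).

Definition unfix_at f i : sef := Sef (subexcedant_set f (m_pred_le f i)).

(* The inord's are harmless: m f i < mlast f forces (m f i).+1 and 1 to be in
   range. *)
Definition circledast f i :=
  [&& f (m f i) < m f i, m f i < mlast f,
      fiber f ord0 == [set ord0; inord 1]
    & [set inord (m f i).+1] \proper fiber f (m f i)].

Definition heart f i := f (m f i) == m f i.
Definition spade f i := (f (m f i) < m f i) && (2 < #|fiber f ord0|).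
Definition diamond f i :=
  circledast f i && (f (m f i.+1) == m f i.+1).
Definition club f i :=
  circledast f i && (f (m f i.+1) < m f i.+1).

(* Nonmatchless functions for which no index is eligible, none of which encodes
   a derangement, are left unchanged. *)
Definition Psi f : sef :=
  if matchless f then f else
  if [seq i <- iota 1 #|IM f|.-1 |
       [|| heart f i, spade f i, diamond f i | club f i]] is i :: _ then
    if heart f i then unfix_at f i
    else if spade f i then fix_at f i
    else if diamond f i then unfix_at f i.+1
    else fix_at f i.+1
  else f.

Definition hatPsi (s : 'S_n.+1) : 'S_n.+1 := sefToPerm (Psi (permToSef s)).

End SubexcedantFunctions.

(* Main.v *)
(* Let sigma = sefToPerm f.  If p is the largest element of its fiber under f
   then sigma(p) = f(p) <= p, and otherwise sigma(p) > p.  Hence EXCv(sigma) is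
   the complement of IM(f), RLMv(sigma) is the set of right-to-left minima of
   the word f, sigma is a derangement iff no fiber of f is {v} with f(v) = v,
   and sgn(sigma) is given by the parity of the number of p with f(p) <> p.

   Let p be the largest element of IM(f) such that f starts like a matchless
   function up to p (with indices from 0: f(j) = j - 1 for 1 <= j <= p, and
   f(j) >= p for j > p), and let q be the next element of IM(f).  When f encodes
   a derangement, f is matchless iff there is no such q, and otherwise f(q) is p
   or q, and Psi toggles f(q) between these two values.  This changes
   neither IM(f), nor p and q, nor the right-to-left minima of f. *)
Require Import Defs.
From mathcomp Require Import all_boot all_order all_fingroup all_algebra.
From mathcomp Require Import zify.

Set Implicit Arguments.
Unset Strict Implicit.
Unset Printing Implicit Defensive.

(** * Reading the statistics of [sefToPerm f] off the word [f] *)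

Section WordToPerm.
Variable n : nat.
Implicit Types (f g : sef n) (p q v : 'I_n.+1) (s : 'S_n.+1).

Definition last_in_fiber f p := forall q : 'I_n.+1, p < q -> f q <> f p.

Lemma exists_last_in_fiber f p :
  exists q, [/\ p <= q, f q = f p & last_in_fiber f q].
Proof.
have [q /eqP fq qmax] := @arg_maxnP _ p (fun q => f q == f p) val (eqxx (f p)).
exists q; split=> // [|r ltqr fr]; first exact: qmax.
by have := qmax r; rewrite fr fq eqxx => /(_ isT); rewrite /= leqNgt ltqr.
Qed.

(** The factors of index below [p] fix [p], the factor of index [p] sends it to [f p], and a later
    factor can only move the current image up to its own index. *)
Lemma sefToPermE f p :
  if [exists q : 'I_n.+1, (p < q) && (f q == f p)] then p < sefToPerm f p
  else sefToPerm f p == f p.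
Proof.
pose P k := (\prod_(0 <= i < k) tperm (inord i) (f (inord i)) : 'S_n.+1)%g.
have PE : sefToPerm f = P n.+1.
  by rewrite /P big_mkord; apply: eq_bigr => i _; rewrite inord_val.
have PS k : k <= n ->
    P k.+1 p = tperm (inord k) (f (inord k)) (P k p).
  by move=> lekn; rewrite /P big_nat_recr //= permM.
have Pfix k : k <= p -> P k p = p.
  elim: k => [|k IHk] ltkp; first by rewrite /P big_nil perm1.
  have lekn : k <= n by have := ltn_ord p; lia.
  rewrite PS // IHk ?(ltnW ltkp) // tpermD //; apply/eqP => E.
    by move: ltkp; rewrite -E inordK // ltnn.
  by have := sef_le f (inord k); rewrite E inordK //; lia.
(* Since the image after the factors [0..k] is at most [k], the factor of index [k.+1] moves it only
   if it equals [f] of that index. While the image is still [f p], this means that [k.+1] is in the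
   fiber of [p]. *)
have main k : p <= k -> k <= n -> P k.+1 p <= k /\
    if [exists q : 'I_n.+1, [&& p < q, q <= k & f q == f p]] then p < P k.+1 p
    else P k.+1 p == f p.
  elim: k => [|k IHk] lepk lekn.
    have p0 : p = inord 0 by apply: val_inj; rewrite /= inordK //; lia.
    rewrite PS // Pfix // -p0 tpermL; split; first by have := sef_le f p; lia.
    by case: existsP => // -[q /and3P[]]; lia.
  have [Ep|neq] := eqVneq (p : nat) k.+1.
    have pk : p = inord k.+1 by apply: val_inj; rewrite /= inordK.
    rewrite PS // Pfix ?Ep // -pk tpermL; split.
      by have := sef_le f p; lia.
    by case: existsP => // -[q /and3P[]]; lia.
  have [] := IHk ltac:(lia) ltac:(lia); set w := P k.+1 p => lewk IH.
  rewrite PS // -/w; set r : 'I_n.+1 := inord k.+1.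
  have rE : r = k.+1 :> nat by rewrite inordK.
  have wr : w != r by apply/eqP => E; move: lewk; rewrite E; lia.
  have frle := sef_le f r.
  case: tpermP => [E|wE|/eqP _ /eqP fw].
  - by rewrite E eqxx in wr.
  - split; first by lia.
    case: existsP IH => [[q /and3P[h1 h2 h3]] _|no IH].
      by case: existsP => [_|[]]; [lia | exists q; rewrite h1 h3 andbT; lia].
    case: existsP => [_|[]]; first by lia.
    by exists r; rewrite rE leqnn -wE (eqP IH) eqxx; lia.
  split; first by lia.
  case: existsP IH => [[q /and3P[h1 h2 h3]] IH|no IH].
    by case: existsP => // -[]; exists q; rewrite h1 h3 andbT; lia.
  case: existsP => // -[q /and3P[h1 h2 h3]].
  have [E|ne] := eqVneq (q : nat) k.+1.
    have qr : q = r by apply: val_inj; rewrite /= E -rE.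
    by case/eqP: fw; rewrite (eqP IH) -qr (eqP h3).
  by case: no; exists q; rewrite h1 h3 andbT; lia.
have [|_] := main n _ (leqnn n); first by rewrite -ltnS.
rewrite -PE.
rewrite (eq_existsb (P2 := fun q : 'I_n.+1 => (p < q) && (f q == f p))) // => q.
by rewrite (_ : q <= n) //= -ltnS.
Qed.

Lemma sefToPerm_last f p : last_in_fiber f p -> sefToPerm f p = f p.
Proof.
move=> lastp; have := sefToPermE f p.
by case: existsP => [[q /andP[/lastp fq /eqP]]|_ /eqP].
Qed.

Lemma sefToPerm_lastP f p : last_in_fiber f p \/ p < sefToPerm f p.
Proof.
have := sefToPermE f p; case: existsP => [_ ?|no _]; [by right | left].
by move=> q ltpq fq; case: no; exists q; rewrite ltpq fq eqxx.
Qed.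

(** As [f q = v] forces [v <= q], this says that no fiber is reduced to a fixed point of [f]. *)
Definition fixless f := forall v, f v = v -> exists2 q : 'I_n.+1, v < q & f q = v.

(** By [sefToPermE], the permutation fixes [v] exactly when [v] is last in its fiber and
    [f v = v]. *)
Lemma derangements_fixless f :
  (sefToPerm f \in derangements n) <-> fixless f.
Proof.
rewrite inE; split=> [/forallP der v fv|fl].
  have [q [levq fq lastq]] := exists_last_in_fiber f v.
  exists q; last by rewrite fq.
  rewrite ltn_neqAle levq andbT; apply: contraNneq (der v) => /val_inj E.
  by rewrite {1}E sefToPerm_last // fq fv.
apply/forallP => v; apply/eqP => sv.
have [lastv|] := sefToPerm_lastP f v; last by rewrite sv ltnn.
have fv : f v = v by rewrite -sefToPerm_last.
by have [q ltvq fq] := fl v fv; apply: (lastv q ltvq); rewrite fq fv.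
Qed.

(** Each value of [f] is the image of the last position of its fiber, which is no excedance. By
    injectivity the remaining values are images of positions that are not last, which are
    excedances. *)
Lemma EXCv_sefToPerm f : EXCv (sefToPerm f) = ~: IM f.
Proof.
apply/setP => v; rewrite inE; apply/imsetP/negP => [[j]|vIM].
  rewrite inE => ltj -> /imsetP[k _ E].
  have [q [_ fq lastq]] := exists_last_in_fiber f k.
  have /perm_inj qj : sefToPerm f q = sefToPerm f j.
    by rewrite E sefToPerm_last.
  by move: ltj; rewrite -qj (sefToPerm_last lastq) ltnNge sef_le.
have vE := permKV (sefToPerm f) v.
exists ((sefToPerm f)^-1 v)%g => //; rewrite inE.
case: (sefToPerm_lastP f ((sefToPerm f)^-1 v)%g) => // /sefToPerm_last E.
by case: vIM; rewrite -vE E; apply: imset_f.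
Qed.

(** Right-to-left minima of the word [f]: the last occurrence of [v] has no smaller value to its
    right, phrased without naming that occurrence. *)
Definition word_RLM f v :=
  v \in IM f /\ forall j, f j < v -> exists2 k : 'I_n.+1, j < k & f k = v.

Lemma RLMv_sefToPerm f v : v \in RLMv (sefToPerm f) <-> word_RLM f v.
Proof.
split=> [/imsetP[i]|[/imsetP[k0 _ ->] vmin]].
  rewrite inE => /forallP/= imin vE.
  have [q [leiq fq lastq]] := exists_last_in_fiber f i.
  (* Otherwise the last position [q] of the fiber is to the right of [i], and its image [f i <= i]
     is below the image of [i]. *)
  have lasti : last_in_fiber f i.
    case: (sefToPerm_lastP f i) => // lti.
    have [Eq|ne] := eqVneq q i; first by rewrite -Eq.
    have := imin q; rewrite ltn_neqAle leiq eq_sym val_eqE ne /=.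
    by rewrite (sefToPerm_last lastq) fq; have := sef_le f i; lia.
  rewrite sefToPerm_last // in vE; split=> [|j]; first by rewrite vE imset_f.
  rewrite vE => ltj; exists i => //.
  (* The image of [r] is [f j], smaller than that of [i], so [r] is to the left of [i], and
     [j <= r]. *)
  have [r [lejr fr lastr]] := exists_last_in_fiber f j.
  have := imin r; rewrite (sefToPerm_last lastr) (sefToPerm_last lasti) fr.
  have : r != i by apply/eqP => E; move: ltj; rewrite -fr E ltnn.
  by rewrite -val_eqE /=; lia.
have [k [_ fk lastk]] := exists_last_in_fiber f k0.
rewrite -fk -(sefToPerm_last lastk); apply: imset_f; rewrite inE.
apply/forallP => j; apply/implyP => ltkj; rewrite (sefToPerm_last lastk).
have [lastj|] := sefToPerm_lastP f j; last by have := sef_le f k; lia.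
rewrite (sefToPerm_last lastj) ltnNge leq_eqVlt; apply/norP; split.
  by apply/eqP => /val_inj; apply: lastk.
apply/negP; rewrite fk => /vmin[k' ltjk' fk'].
by apply: (lastk k'); [lia | rewrite fk' fk].
Qed.

(** Only the factor of index [p] changes, from the identity to a genuine transposition. *)
Lemma sgn_sefToPerm_fix f g p :
  (forall q, q != p -> f q = g q) -> f p = p -> g p != p ->
  sgn (sefToPerm g) = (- sgn (sefToPerm f))%R.
Proof.
have oddE h : odd_perm (sefToPerm h) = \big[addb/false]_(i < n.+1) (i != h i).
  rewrite /sefToPerm (big_morph _ (@odd_permM _) (odd_perm1 _)).
  by apply: eq_bigr => i _; rewrite odd_tperm.
move=> fg fp gp; rewrite /sgn !oddE (bigD1 p) //= [in RHS](bigD1 p) //=.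
rewrite fp eqxx eq_sym gp [in RHS](eq_bigr (fun i => i != g i)) => [|q /fg -> //].
by rewrite addTb addFb GRing.signrN.
Qed.

End WordToPerm.

(** * Chains, levels, and toggling a single value *)

Section Toggle.
Variable n : nat.
Implicit Types (f g : sef n) (p q v : 'I_n.+1) (k : nat).

Lemma IM_im f p : f p \in IM f.
Proof. exact: imset_f. Qed.

Definition chain f k :=
  forall j : 'I_n.+1, if j <= k then f j = j.-1 :> nat else k <= f j.

(** Testing maximality against [p.+1] alone suffices: by [chain_le] and [chain_IM], a chain up to
    any larger element of the image yields one up to [p.+1] with [p.+1] in the image. *)
Definition level f p :=
  [/\ chain f p, p \in IM f
    & forall q : 'I_n.+1, q = p.+1 :> nat -> q \in IM f -> ~ chain f q].

Definition next_value f p q :=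
  [/\ q \in IM f, p < q & forall v, v \in IM f -> p < v -> q <= v].

Definition differ_at f g p := forall q, q != p -> g q = f q.

Lemma chain0 f : chain f 0.
Proof. by move=> j; case: ifP => //; have := sef_le f j; lia. Qed.

Lemma chain_pred f k : chain f k.+1 -> chain f k.
Proof.
move=> ch j; have := ch j.
by case: (leqP j k) => h1; case: (leqP j k.+1) => h2; lia.
Qed.

Lemma chain_le f (j k : nat) : j <= k -> chain f k -> chain f j.
Proof.
elim: k => [|k IHk]; first by rewrite leqn0 => /eqP->.
by rewrite leq_eqVlt => /orP[/eqP-> // | /IHk IH /chain_pred].
Qed.

Lemma chain_IM f k v : chain f k -> v < k -> k <= n -> v \in IM f.
Proof.
move=> ch ltvk lekn.
have := ch (inord v.+1); rewrite inordK ?ltnS; last exact: leq_trans lekn.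
rewrite ltvk /= => /val_inj <-; exact: IM_im.
Qed.

Lemma exists_level f : exists p, level f p.
Proof.
pose P p := [forall j : 'I_n.+1,
  if j <= p then f j == j.-1 :> nat else p <= f j] && (p \in IM f).
have PP p : reflect (chain f p /\ p \in IM f) (P p).
  apply: (iffP andP) => -[ch pIM]; split=> //.
    by move=> j; have /forallP/(_ j) := ch; case: ifP => // _ /eqP.
  by apply/forallP => j; have := ch j; case: ifP => // _ ->.
have P0 : P ord0.
  apply/PP; split; first exact: chain0.
  suff <- : f ord0 = ord0 by apply: IM_im.
  by apply: val_inj; have := sef_le f ord0; rewrite /=; lia.
have [p /PP[ch pIM] pmax] := @arg_maxnP _ ord0 P val P0.
exists p; split=> // q Eq qIM chq.
have := pmax q; rewrite /= Eq ltnn => h.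
by have/PP/h : chain f q /\ q \in IM f by [].
Qed.

(** The word is nondecreasing up to position [p] and at least [p] afterwards, so every value below
    [v] occurs to the left of every occurrence of [v]. *)
Lemma chain_RLM f p v : chain f p -> p \in IM f -> v \in IM f -> v <= p ->
  word_RLM f v.
Proof.
move=> ch pIM vIM levp; split=> // j ltj.
case/imsetP: vIM => r _ Er; exists r => //.
have := ch j; have := ch r; rewrite -Er; have := sef_le f r; rewrite -Er.
by case: (leqP r p); case: (leqP j p); lia.
Qed.

(** * Two functions that differ only at [p], with values [p] and [k] there *)

Section Pair.
Variables (f g : sef n) (k p : 'I_n.+1).
Hypotheses (fgp : differ_at f g p) (fp : f p = p) (gp : g p = k).

(** Fixlessness of [f] provides a later occurrence [q] of the value [p], which keeps [p] in the
    image once position [p] is sent to [k]. *)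
Lemma toggle_down : fixless f -> level f k -> next_value f k p ->
  [/\ IM g = IM f, fixless g & level g k].
Proof.
move=> ff [ch kIM kmax] [pIM ltkp pmin].
have [q ltpq fq] := ff p fp.
have gq : g q = p.
  by rewrite fgp //; apply/eqP => E; rewrite E ltnn in ltpq.
have IMg : IM g = IM f.
  apply/setP => v; apply/imsetP/imsetP => -[r _ ->].
    have [->|ne] := eqVneq r p; last by exists r; rewrite ?fgp.
    by rewrite gp; case/imsetP: kIM => s _ ->; exists s.
  have [->|ne] := eqVneq r p; last by exists r; rewrite ?fgp.
  by exists q; rewrite ?fp.
have chg : chain g k.
  move=> j; have [->|ne] := eqVneq j p; last by rewrite fgp //; apply: ch.
  by rewrite gp leqNgt ltkp /=.
split=> //.
  move=> v gv; have [vp|ne] := eqVneq v p; first by exists q; rewrite vp.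
  have [r ltvr fr] := ff v (etrans (esym (fgp ne)) gv).
  have [Er|ner] := eqVneq r p; last by exists r; rewrite ?fgp.
  by case/eqP: ne; rewrite -fr Er.
split; rewrite ?IMg // => r Er rIM chr.
have rp : r = p.
  apply: val_inj; have := pmin r rIM; have := chr p; rewrite gp Er ltnSn /=.
  by case: (leqP p k.+1) => h1 h2 h3; have := h3 isT; lia.
(* The chain [chr] for [g] ends at [k.+1], which is [p]. The value [k] has an occurrence [k'] past
   [k] other than [p], hence past [k.+1], where that chain only allows values above [k]. *)
have [k' /andP[fk' nek'p] ltkk'] :
    exists2 k' : 'I_n.+1, (f k' == k) && (k' != p) & k < k'.
  have [Ek|/eqP ne] := eqVneq (f k) k.
    have [k' ltkk' fk'] := ff k Ek; exists k' => //.
    rewrite fk' eqxx; apply/eqP => E; move: fk'; rewrite E fp => E'.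
    by rewrite E' ltnn in ltkp.
  case/imsetP: kIM => k' _ Ek; exists k'; last first.
    rewrite ltn_neqAle {2}Ek sef_le andbT; apply/eqP => /val_inj E.
    by case: ne; rewrite {1}E.
  rewrite -Ek eqxx; apply/eqP => E; move: Ek; rewrite E fp => E'.
  by rewrite E' ltnn in ltkp.
have := chr k'; rewrite fgp // (eqP fk') Er.
move: nek'p (congr1 val rp); rewrite -val_eqE /= Er.
by case: (leqP k' k.+1); lia.
Qed.

(** The point is that [k] stays in the image, and keeps an occurrence past [k], when position [p]
    stops carrying it; this comes from the maximality of the level. *)
Lemma toggle_up : fixless g -> level g k -> next_value g k p ->
  [/\ IM f = IM g, fixless f & level f k].
Proof.
move=> fg [ch kIM kmax] [pIM ltkp pmin].
have gfp r : r != p -> f r = g r by move=> ?; rewrite fgp.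
have [q gq] : exists q, g q = p by case/imsetP: pIM => q _ Eq; exists q.
have ltpq : p < q.
  rewrite ltn_neqAle -{2}gq sef_le andbT; apply/eqP => /val_inj E.
  by move: gq; rewrite -E gp => E'; rewrite E' ltnn in ltkp.
have neqp : q != p by apply/eqP => E; rewrite E ltnn in ltpq.
(* The first candidate is position [k.+1], whose value can only be [k] or [k.+1]. *)
have [k' gk' [ltkk' nek']] : exists2 k' : 'I_n.+1, g k' = k & k < k' /\ k' != p.
  have ltkn : k.+1 <= n by have := ltn_ord p; lia.
  pose r : 'I_n.+1 := inord k.+1.
  have rE : r = k.+1 :> nat by rewrite inordK.
  have := ch r; rewrite rE ltnn => legr; have := sef_le g r; rewrite rE => lerg.
  have [gr|gr] : g r = k \/ g r = r.
  - have [E|ne] := eqVneq (g r : nat) k; [left|right]; apply: val_inj => //=.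
    by lia.
  - have [rp|ne] := eqVneq r p; last by exists r; rewrite ?rE.
    (* If [p = k.+1] were the only position past [k] with value [k], then [g] would be a chain up to
       [k.+1], against the maximality of [k]. *)
    case: (boolP [exists k' : 'I_n.+1, [&& g k' == k, k < k' & k' != p]]).
      by case/existsP => k' /and3P[/eqP ? ? ?]; exists k'.
    move/existsPn => no; case: (kmax r rE); first by rewrite rp.
    move=> j; have := ch j; rewrite rE; case: (leqP j k) => [/leqW-> //|ltkj].
    case: (leqP j k.+1) => [lejk _|ltkj' legj].
      have jr : j = r by apply: val_inj; rewrite /= rE; lia.
      by rewrite jr gr rE.
    have := no j; rewrite ltkj (_ : j != p) ?andbT /=; last first.
      by rewrite -rp -val_eqE /= rE; lia.
    by rewrite -val_eqE /=; lia.
  (* Here [k.+1] is itself a value of [g], hence the next value [p]; but [g p] is [k]. *)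
  have rp : r = p.
    apply: val_inj; apply/eqP; rewrite /= eqn_leq.
    by rewrite {1}rE ltkp pmin ?rE // -gr IM_im.
  by move: gr; rewrite rp gp => E; rewrite E ltnn in ltkp.
have IMf : IM f = IM g.
  apply/setP => v; apply/imsetP/imsetP => -[r _ ->].
    have [->|ne] := eqVneq r p; last by exists r; rewrite ?gfp.
    by exists q; rewrite ?fp.
  have [->|ne] := eqVneq r p; last by exists r; rewrite ?gfp.
  by exists k'; rewrite ?gp ?gfp.
have chf : chain f k.
  move=> j; have [->|ne] := eqVneq j p; last by rewrite gfp //; apply: ch.
  by rewrite fp leqNgt ltkp /= ltnW.
split=> //.
  move=> v fv; have [vp|ne] := eqVneq v p; first by exists q; rewrite ?vp ?gfp.
  have [r ltvr gr] := fg v (etrans (esym (gfp _ ne)) fv).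
  have [Er|ner] := eqVneq r p; last by exists r; rewrite ?gfp.
  by move: gr; rewrite Er gp => <-; exists k'; rewrite ?gfp.
split; rewrite ?IMf // => r Er rIM chr.
have := pmin r rIM; have := chr p; rewrite Er fp ltnSn.
by case: (leqP p k.+1) => h1 h2 h3; have := h3 isT; lia.
Qed.

(** Values up to [k] are settled by [chain_RLM]. For larger [v], the later occurrence [q] of [p]
    makes position [p] irrelevant: it replaces [p] as a witness for the value [p], and the condition
    at [q] implies the one at [p]. *)
Lemma toggle_RLM v : chain f k -> chain g k -> k \in IM f ->
    IM g = IM f -> fixless f -> next_value f k p ->
  word_RLM f v <-> word_RLM g v.
Proof.
move=> chf chg kIM IMg ff [pIM ltkp pmin].
have [levk|ltkv] := leqP v k.
  case: (boolP (v \in IM f)) => [vIM|vIM]; last first.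
    by split=> -[]; rewrite ?IMg (negPf vIM).
  by split=> _; apply: chain_RLM levk; rewrite ?IMg.
have [q ltpq fq] := ff p fp.
have neqp : q != p by apply/eqP => E; rewrite E ltnn in ltpq.
have gq : g q = p by rewrite fgp.
(* A value [v > k] of the image is at least [p]: either [v = p] occurs at [q], or the smaller value
   at [q] forces an occurrence of [v] after [q]. *)
have keep (h : sef n) : h q = p -> v \in IM f ->
    (forall j : 'I_n.+1, h j < v -> exists2 k' : 'I_n.+1, j < k' & h k' = v) ->
    exists2 r : 'I_n.+1, p < r & h r = v.
  move=> hq vIM Av; have [vp|ne] := eqVneq v p; first by exists q; rewrite ?vp.
  have [|r ltqr hr] := Av q; last by exists r => //; lia.
  by rewrite hq ltn_neqAle eq_sym val_eqE ne pmin.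
split=> -[vIM Av]; (split; first by rewrite ?IMg // -IMg).
  move=> j; have [->|ne] := eqVneq j p => [_|].
    have [r ltpr fr] := keep f fq vIM Av.
    by exists r; rewrite ?fgp //; apply/eqP => E; rewrite E ltnn in ltpr.
  rewrite fgp // => /Av[r ltjr fr]; have [Er|ner] := eqVneq r p.
    by exists q; [rewrite Er in ltjr; lia | rewrite gq -fp -Er].
  by exists r; rewrite ?fgp.
rewrite IMg in vIM.
move=> j; have [->|ne] := eqVneq j p => [_|].
  have [r ltpr gr] := keep g gq vIM Av.
  by exists r => //; rewrite -fgp //; apply/eqP => E; rewrite E ltnn in ltpr.
rewrite -fgp // => /Av[r ltjr gr]; have [Er|ner] := eqVneq r p.
  by move: ltkv; rewrite -gr Er gp ltnn.
by exists r; rewrite -?fgp.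
Qed.

End Pair.
End Toggle.

(** * The enumeration of the image, and levels of matchless functions *)

Section ToggleByPsi.
Variable n : nat.
Implicit Types (f g : sef n) (p q r v : 'I_n.+1) (i j k : nat).

Lemma m_mono f i j : i <= j -> m f i <= m f j.
Proof.
elim: j => [|j IHj]; first by rewrite leqn0 => /eqP->.
rewrite leq_eqVlt => /orP[/eqP-> // | /IHj le_mij].
exact: leq_trans le_mij (m_pred_le f j.+1).
Qed.

Lemma m_IM f i : i < #|IM f| -> m f i \in IM f.
Proof. by move=> lti; rewrite -mem_enum mem_nth // -cardE. Qed.

Lemma IM_m f v : v \in IM f -> exists2 i, i < #|IM f| & m f i = v.
Proof.
rewrite -mem_enum => vIM; exists (index v (enum (IM f))); last exact: nth_index.
by rewrite cardE index_mem.
Qed.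

Lemma m_lt f i j : i < j -> j < #|IM f| -> m f i < m f j.
Proof.
move=> ltij ltj; rewrite ltn_neqAle m_mono ?(ltnW ltij) // andbT.
by rewrite val_eqE nth_uniq ?enum_uniq -?cardE ?(ltn_eqF ltij) ?(ltn_trans ltij).
Qed.

Lemma m_ge f i : i < #|IM f| -> i <= m f i.
Proof.
elim: i => // i IHi lti; apply: leq_ltn_trans (IHi (ltnW lti)) _.
exact: m_lt.
Qed.

(** The image contains all of [0..p], so its enumeration starts with these values. *)
Lemma m_small f p i : chain f p -> p \in IM f -> i <= p -> m f i = i :> nat.
Proof.
move=> ch pIM; elim/ltn_ind: i => i IHi leip.
pose v : 'I_n.+1 := inord i.
have vE : v = i :> nat by rewrite inordK //; have := ltn_ord p; lia.
have vIM : v \in IM f.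
  have [ltip|lepi] := ltnP i p.
    by apply: chain_IM ch _ _; rewrite ?vE // -ltnS.
  by rewrite (_ : v = p) //; apply: val_inj; rewrite /= vE; lia.
have [j ltj Ej] := IM_m vIM.
have leji : j <= i by rewrite -vE -Ej m_ge.
have [E|ne] := eqVneq j i; first by rewrite E in Ej; rewrite Ej.
have ltji : j < i by lia.
have := IHi j ltji (leq_trans leji leip); rewrite Ej vE => E.
by rewrite E ltnn in ltji.
Qed.

Lemma m_next f p : chain f p -> p \in IM f -> p.+1 < #|IM f| ->
  next_value f p (m f p.+1).
Proof.
move=> ch pIM ltp; have mp := m_small ch pIM (leqnn p); split.
- exact: m_IM.
- by rewrite -[X in X < _]mp m_lt.
- move=> v /IM_m[j _ <-] ltpj; apply: m_mono; rewrite ltnNge.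
  by apply/negP => lejp; move: ltpj; rewrite (m_small ch pIM lejp); lia.
Qed.

Lemma matchless_level f p : fixless f -> level f p ->
  #|IM f| <= p.+1 -> matchless f.
Proof.
move=> ff [ch pIM _] leIM.
have fle r : f r <= p.
  have [j ltj <-] := IM_m (IM_im f r).
  have lejp : j <= p by lia.
  by rewrite (m_small ch pIM lejp).
(* The parameter of a matchless function lies in ['I_n]. If [p = n], the last position would be
   fixed by [f], with no later position to share its value. *)
have ltpn : p < n.
  rewrite ltn_neqAle -ltnS ltn_ord andbT; apply/eqP => Ep.
  case/imsetP: pIM => r _ Er.
  have rp : r = p.
    by apply: val_inj; have := sef_le f r; have := ltn_ord r; rewrite -Er /=; lia.
  have [q] := ff p (etrans (congr1 f (esym rp)) (esym Er)).
  by have := ltn_ord q; lia.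
apply/existsP; exists (Ordinal ltpn); apply/forallP => j /=.
have := ch j; have := fle j; case: (leqP j p) => h1 h2 h3; apply/eqP; lia.
Qed.

(** A matchless function with parameter [k] is a chain up to [k]. A value above [p] forces [p < k],
    and then position [p.+2] has value [p.+1], so [p] is not maximal. *)
Lemma not_matchless_level f p : level f p -> p.+1 < #|IM f| -> ~~ matchless f.
Proof.
move=> [ch pIM pmax] ltp; apply/negP => /existsP[k /forallP fE].
have {}fE (j : 'I_n.+1) : f j = minn j.-1 k :> nat by apply/eqP/fE.
have chk : chain f k by move=> j; rewrite fE; case: (leqP j k); lia.
have [qIM ltpq _] := m_next ch pIM ltp.
have ltpk : p < k.
  by case/imsetP: qIM => r _ E; move: ltpq; rewrite E fE; lia.
pose r : 'I_n.+1 := inord p.+1.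
have rE : r = p.+1 :> nat by rewrite inordK //; have := ltn_ord k; lia.
apply: (pmax r rE); last by rewrite rE; apply: chain_le chk.
have <- : f (inord p.+2) = r; last exact: IM_im.
have rrE : (inord p.+2 : 'I_n.+1) = p.+2 :> nat.
  by rewrite inordK //; have := ltn_ord k; lia.
by apply: val_inj; rewrite /= fE rrE rE; lia.
Qed.

(** No value lies strictly between [p] and [q], so [f q = p] and position [p.+1] has value [p] too.
    Without a second such position, [q = p.+1] would extend the chain. The two positions serve to
    verify [circledast] or [spade]. *)
Lemma level_fiber f p q : level f p -> next_value f p q -> f q <> q ->
  exists r s : 'I_n.+1, [/\ r = p.+1 :> nat, r < s, f r = p, f s = p & f q = p].
Proof.
move=> [ch pIM pmax] [qIM ltpq qmin] fq.
have fqp : f q = p.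
  have lepfq : p <= f q by have := ch q; rewrite leqNgt ltpq.
  have [ltpfq|lefqp] := ltnP p (f q); last by apply: val_inj; rewrite /=; lia.
  case: fq; apply: val_inj; have := qmin _ (IM_im f q) ltpfq.
  by have := sef_le f q; rewrite /=; lia.
pose r : 'I_n.+1 := inord p.+1.
have rE : r = p.+1 :> nat by rewrite inordK //; have := ltn_ord q; lia.
have frp : f r = p.
  apply: val_inj; have := ch r; have := sef_le f r; rewrite rE ltnn => h1 h2.
  have [/=E|ne] := eqVneq (f r : nat) p.+1; last by rewrite /=; lia.
  have fr : f r = r by apply: val_inj; rewrite /= E.
  have leqr : q <= r by apply: qmin; [rewrite -fr; exact: IM_im | rewrite rE].
  by case: fq; rewrite (_ : q = r) //; apply: val_inj; rewrite /=; lia.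
have [Eq|ne] := eqVneq q r; last first.
  exists r, q; split=> //; rewrite ltn_neqAle eq_sym val_eqE ne /=.
  by rewrite rE.
case: (boolP [exists s : 'I_n.+1, (r < s) && (f s == p)]) => [|/existsPn no].
  by case/existsP => s /andP[? /eqP ?]; exists r, s.
case: (pmax r rE); first by rewrite -Eq.
move=> j; have := ch j; rewrite rE; case: (leqP j p) => [/leqW-> //|ltpj].
case: (leqP j p.+1) => [lejp _|ltrj lepj].
  have -> : j = r by apply: val_inj; rewrite /= rE; lia.
  by rewrite frp rE.
by have := no j; rewrite rE ltrj /= -val_eqE /=; lia.
Qed.

(** * The first eligible index *)

Definition eligible f i := [|| heart f i, spade f i, diamond f i | club f i].

Lemma PsiE f i : ~~ matchless f -> 0 < i < #|IM f| ->
    (forall j, 0 < j < i -> ~~ eligible f j) -> eligible f i ->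
  Psi f = if heart f i then unfix_at f i
    else if spade f i then fix_at f i
    else if diamond f i then unfix_at f i.+1
    else fix_at f i.+1.
Proof.
move=> /negPf fm /andP[i_gt0 lti] no yes; rewrite /Psi fm -/(eligible f).
have -> : #|IM f|.-1 = i.-1 + (1 + (#|IM f|.-1 - i)) by lia.
rewrite iotaD filter_cat add1n (prednK i_gt0) /= -/(eligible f i) yes.
rewrite (eq_in_filter (a2 := pred0)) ?filter_pred0 // => j.
by rewrite mem_iota => ?; apply/negbTE/no; lia.
Qed.

Lemma eligibleE f i : eligible f i =
  [|| heart f i, spade f i | circledast f i].
Proof.
rewrite /eligible /diamond /club -andb_orr; set q := m f i.+1.
have -> : (f q == q) || (f q < q) by rewrite -val_eqE -leq_eqVlt sef_le.
by rewrite andbT.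
Qed.

Lemma chain_fiber0 f k : chain f k -> 0 < k <= n ->
  fiber f ord0 = [set ord0; inord 1].
Proof.
move=> ch /andP[k_gt0 lekn]; apply/setP => j; rewrite !inE -!val_eqE /=.
rewrite inordK; last by lia.
by have := ch j; case: (leqP j k); lia.
Qed.

Lemma chain_fiber f k v : chain f k -> 0 < v < k -> k <= n ->
  fiber f v = [set inord v.+1].
Proof.
move=> ch /andP[v_gt0 ltvk] lekn; apply/setP => j; rewrite !inE -!val_eqE /=.
rewrite inordK; last by lia.
by have := ch j; case: (leqP j k); lia.
Qed.

Lemma not_heart_spade f p i : chain f p -> p \in IM f -> 0 < i <= p ->
  heart f i = false /\ spade f i = false.
Proof.
move=> ch pIM /andP[i_gt0 leip]; have mi := m_small ch pIM leip.
split.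
  rewrite /heart -val_eqE /=; have := ch (m f i); rewrite mi leip /=; lia.
rewrite /spade (chain_fiber0 ch) ?cards2; first by case: (_ != _); rewrite andbF.
by have := ltn_ord p; lia.
Qed.

(** Inside the chain the fiber of [i] is only [i.+1], so the proper inclusion in [circledast]
    fails. *)
Lemma not_eligible_chain f p i : chain f p -> p \in IM f -> 0 < i < p ->
  ~~ eligible f i.
Proof.
move=> ch pIM /andP[i_gt0 ltip]; have mi := m_small ch pIM (ltnW ltip).
rewrite eligibleE; have [| -> ->] := not_heart_spade ch pIM (i := i); first lia.
have fibE : fiber f (m f i) = [set inord (m f i).+1].
  by apply: chain_fiber ch _ _; rewrite ?mi ?i_gt0 // -ltnS.
by rewrite /circledast fibE properxx !andbF.
Qed.

(** The first eligible index is [p], through [circledast], whose two cases act at [p.+1], or else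
    [p.+1] itself, through [heart] or [spade]. Either way the value at [m f p.+1] is changed. *)
Lemma Psi_level f p : level f p -> p.+1 < #|IM f| ->
  Psi f = if f (m f p.+1) == m f p.+1 then unfix_at f p.+1 else fix_at f p.+1.
Proof.
move=> lev ltp; have fm := not_matchless_level lev ltp.
have [ch pIM pmax] := lev; have nxt := m_next ch pIM ltp.
have mp := m_small ch pIM (leqnn p).
have mpE : m f p = p by apply: val_inj.
have no j : 0 < j < p -> ~~ eligible f j by apply: not_eligible_chain.
have [p_gt0|p0] := posnP p; last first.
  have [hp sp] := not_heart_spade ch pIM (i := p) ltac:(lia).
  have [cp|cp] := boolP (circledast f p).
    rewrite (PsiE fm _ no); last by rewrite eligibleE cp !orbT.
      by rewrite hp sp /diamond cp.
    by lia.
  (* If the next value were not fixed, [level_fiber] would give two positions of value [p] and hence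
     [circledast f p]. *)
  have hq : f (m f p.+1) == m f p.+1.
    apply: contraNT cp => /eqP fq.
    have [r [s [rE ltrs fr fs fqp]]] := level_fiber lev nxt fq.
    have -> : circledast f p = true; last by [].
    apply/and4P; split; rewrite ?mpE.
    - by have := ch p; rewrite leqnn; lia.
    - rewrite -{1}mpE; apply: leq_trans (m_lt (leqnn p.+1) ltp) _.
      by apply: m_mono; lia.
    - by rewrite (chain_fiber0 ch) //; have := ltn_ord p; lia.
    rewrite -rE inord_val; apply/properP; split.
      by rewrite sub1set inE fr.
    exists s; rewrite !inE ?fs //; apply/eqP => E.
    by rewrite E ltnn in ltrs.
  rewrite hq (@PsiE f p.+1 fm) ?/heart ?hq //.
    move=> j /andP[j_gt0 ]; rewrite ltnS leq_eqVlt => /orP[/eqP->|ltjp].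
      by rewrite eligibleE hp sp (negPf cp).
    by apply: no; rewrite j_gt0.
  by rewrite eligibleE /heart hq.
have no1 j : 0 < j < p.+1 -> ~~ eligible f j by lia.
have [hq|/eqP fq] := boolP (f (m f p.+1) == m f p.+1).
  by rewrite (PsiE fm _ no1) // ?eligibleE /heart hq.
have [r [s [rE ltrs fr fs fqp]]] := level_fiber lev nxt fq.
have pE : p = ord0 by apply: val_inj.
have fp : f p = p by apply: val_inj; have := sef_le f p; rewrite /=; lia.
(* With [p = 0], the positions [p], [r] and [s] all carry the value 0. *)
have sp : spade f p.+1.
  rewrite /spade fqp; have [_ -> _] := nxt; rewrite -pE /=.
  have uniq_prs : uniq [:: p; r; s].
    by rewrite /= !inE -!val_eqE /=; lia.
  rewrite -[3]/(size [:: p; r; s]) -(card_uniqP uniq_prs).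
  apply/subset_leq_card/subsetP => j; rewrite !inE.
  by case/or3P => /eqP->; rewrite ?fp ?fr ?fs.
by rewrite (PsiE fm _ no1) ?eligibleE ?sp ?orbT // /heart (negPf (introN eqP fq)).
Qed.

(** * The effect of [Psi] on fixless functions *)

Lemma fix_atE f i q : fix_at f i q = if q == m f i then m f i else f q.
Proof. exact: ffunE. Qed.

Lemma unfix_atE f i q : unfix_at f i q = if q == m f i then m f i.-1 else f q.
Proof. exact: ffunE. Qed.

Lemma sef_eq f g : f =1 g -> f = g.
Proof. by move=> fg; apply/val_inj/ffunP. Qed.

Lemma Psi_matchless f : matchless f -> Psi f = f.
Proof. by rewrite /Psi => ->. Qed.

(** The level [p] and the image survive the toggle, so [Psi_level] applies again at the same [q] and
    restores the former value. *)
Lemma Psi_toggle f : fixless f -> ~~ matchless f ->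
  [/\ fixless (Psi f), Psi (Psi f) = f, IM (Psi f) = IM f,
      forall v, word_RLM f v <-> word_RLM (Psi f) v
    & sgn (sefToPerm (Psi f)) = (- sgn (sefToPerm f))%R].
Proof.
move=> ff fm; have [p lev] := exists_level f.
have ltp : p.+1 < #|IM f|.
  by rewrite ltnNge; apply: contra fm => /(matchless_level ff lev).
have [ch pIM _] := lev; have nxt := m_next ch pIM ltp.
have mp : m f p = p by apply: val_inj; apply: m_small ch pIM _.
set g := Psi f; move: (Psi_level lev ltp); rewrite -/g.
set q := m f p.+1 in nxt *; have [_ ltpq _] := nxt.
have [fq|fq] := eqVneq (f q) q => gE.
  have gq : g q = p by rewrite gE unfix_atE eqxx.
  have gfq : differ_at f g q by move=> r /negPf ne; rewrite gE unfix_atE -/q ne.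
  have [IMg fg levg] := toggle_down gfq fq gq ff lev nxt.
  have mg i : m g i = m f i by rewrite /m IMg.
  split=> //.
  - apply: sef_eq => r; rewrite (Psi_level levg) ?IMg // mg -/q gq.
    have /negPf -> : p != q by rewrite -val_eqE /=; lia.
    by rewrite fix_atE mg -/q; case: eqVneq => [->|/gfq].
  - by move=> v; have [chg _ _] := levg; apply: (toggle_RLM gfq fq gq).
  - apply: (@sgn_sefToPerm_fix n f g q) => //.
      by move=> r /gfq.
    by rewrite gq -val_eqE /=; lia.
have [_ [_ [_ _ _ _ fqp]]] := level_fiber lev nxt (elimN eqP fq).
have gq : g q = q by rewrite gE fix_atE eqxx.
have fgq : differ_at g f q by move=> r /negPf ne; rewrite gE fix_atE -/q ne.
have [IMg fg levg] := toggle_up fgq gq fqp ff lev nxt.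
have mg i : m g i = m f i by rewrite /m IMg.
have nxtg : next_value g p q by rewrite /next_value IMg.
split=> //.
- apply: sef_eq => r; rewrite (Psi_level levg) ?IMg // mg -/q gq eqxx.
  by rewrite unfix_atE !mg mp -/q; case: eqVneq => [->|/fgq].
- move=> v; have [chg pIMg _] := levg; apply: iff_sym.
  by apply: (toggle_RLM fgq gq fqp) => //; rewrite IMg.
- have -> := @sgn_sefToPerm_fix n g f q; rewrite ?GRing.opprK //.
  by move=> r /fgq.
Qed.

Lemma Psi_fixless f : fixless f ->
  [/\ fixless (Psi f), Psi (Psi f) = f, IM (Psi f) = IM f
    & forall v, word_RLM f v <-> word_RLM (Psi f) v].
Proof.
move=> ff; have [fm|fm] := boolP (matchless f); last by case: (Psi_toggle ff fm).
by rewrite !Psi_matchless.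
Qed.

End ToggleByPsi.

Theorem corollary20 (n : nat) :
  (forall s : 'S_n.+1, s \in derangements n -> hatPsi s \in derangements n) /\
  (forall s : 'S_n.+1, s \in derangements n -> hatPsi (hatPsi s) = s) /\
  (forall s : 'S_n.+1, s \in derangements n -> EXCv (hatPsi s) = EXCv s) /\
  (forall s : 'S_n.+1, s \in derangements n -> RLMv (hatPsi s) = RLMv s) /\
  (forall s : 'S_n.+1, s \in derangements_star n ->
     sgn (hatPsi s) = (- sgn s)%R).
Proof.
have der s : s \in derangements n -> fixless (permToSef s).
  by rewrite -{1}(permToSefK s) => /derangements_fixless.
split=> [s /der ds|].
  by have [ds' _ _ _] := Psi_fixless ds; apply/derangements_fixless.
split=> [s /der ds|].
  by have [_ PP _ _] := Psi_fixless ds; rewrite /hatPsi sefToPermK PP permToSefK.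
split=> [s /der ds|].
  have [_ _ IMP _] := Psi_fixless ds.
  by rewrite -[in RHS](permToSefK s) !EXCv_sefToPerm IMP.
split=> [s /der ds|s].
  have [_ _ _ RLM] := Psi_fixless ds.
  rewrite -[in RHS](permToSefK s); apply/setP => v.
  by apply/idP/idP => /RLMv_sefToPerm/RLM/RLMv_sefToPerm.
rewrite inE => /andP[/der ds nm]; have [_ _ _ _ E] := Psi_toggle ds nm.
by rewrite /hatPsi E permToSefK.
Qed.
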